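(* Let $A$ be a real isotropic $d\times d$ dilation matrix, let $m\ge1$, and let $\phi^m$ be the corresponding elliptic scaling function of order $m$. Then $\phi^m$ is totally positive, in the sense that $$\hat\phi^m(\xi)\ge0\qquad\text{for all }\xi\in\mathbb{R}^d.$$
   Context: A real isotropic dilation matrix is a $d\times d$ matrix $A$ with integer entries, all of whose eigenvalues are greater than $1$ in absolute value, which is diagonalizable over $\mathbb{C}$ and all of whose eigenvalues have equal absolute value. Put $q:=|\det A|$ and $A^{-T}:=(A^T)^{-1}$. One can factor $A^{-T}=q^{-1/d}Q^{-1}UQ$ with $U$ real orthogonal and $Q$ real symmetric positive definite; fix such a $Q$ and write $Q^2=(q_{ij})_{1\le i,j\le d}$. Define $$P(\xi):=\xi^TQ^2\xi=\sum_{i} q_{ii}\xi_i^2+2\sum_{i<j}q_{ij}\xi_i\xi_j,\qquad G(\xi):=4\sum_{i} q_{ii}\sin^2\frac{\xi_i}{2}+2\sum_{i<j}q_{ij}\sin\xi_i\sin\xi_j .$$ Let $S(A^T):=\{s\in[0,1)^d: A^Ts\in\mathbb{Z}^d\}$ (this set has $q$ elements and contains $0$), and define the mask $$m_0(\xi):=\prod_{s\in S(A^T)\setminus\{0\}}\frac{G(\xi+2\pi s)}{G(2\pi s)}.$$ Define $$\mu(\xi):=\frac{q^{2/d}\,m_0(A^{-T}\xi)\,G(A^{-T}\xi)}{G(\xi)},$$ where at the points of $2\pi\mathbb{Z}^d$ (zeros of $G$) the value is understood as the limit, and $M(\xi):=\prod_{j=0}^\infty\mu\bigl((A^{-T})^j\xi\bigr)$.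 The elliptic scaling function $\phi$ is the tempered distribution with $\hat\phi(\xi)=\prod_{j=1}^\infty m_0((A^{-T})^j\xi)=\frac{G(\xi)}{P(\xi)}M(\xi)$ (with $G/P:=1$ at $\xi=0$); it is compactly supported. The elliptic scaling function of order $m$ is $\phi^1:=\phi$, $\phi^m:=\phi*\phi^{m-1}$, i.e. $\hat\phi^m(\xi)=(\hat\phi(\xi))^m$. The Fourier transform is $\hat f(\xi)=\int_{\mathbb{R}^d} f(x)e^{-i\xi\cdot x}\,dx$. For functions, total positivity of $f$ means $\sum_{i,j=1}^k z_i\overline{z_j}f(x_i-x_j)\ge0$ for all $k$, $x_1,\dots,x_k\in\mathbb{R}^d$, $z_1,\dots,z_k\in\mathbb{C}$, which is known to be equivalent to $\hat f(\xi)\ge0$ for all $\xi\in\mathbb{R}^d$. *)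

(* Defs.v *)
From HB Require Import structures.
From mathcomp Require Import all_boot all_order all_algebra.
From mathcomp Require Import complex.
From mathcomp Require Import all_classical all_reals all_analysis.

Set Implicit Arguments.
Unset Strict Implicit.
Unset Printing Implicit Defensive.

Import Order.TTheory GRing.Theory Num.Theory.
Import numFieldNormedType.Exports.

Local Open Scope classical_set_scope.
Local Open Scope ring_scope.

Section Elliptic.
Variables (R : realType) (d : nat).
Implicit Types (A : 'M[int]_d) (Q U : 'M[R]_d) (xi s : 'cV[R]_d).

(* [eigenvalue] uses row eigenvectors; the eigenvalues are the same as those
   for column eigenvectors. *)
Definition isotropic_dilation A : Prop :=
  let AC : 'M[R[i]]_d := map_mx intr A in
  [/\ forall z, eigenvalue AC z -> 1 < `|z|,
      diagonalizable AC
    & forall z w, eigenvalue AC z -> eigenvalue AC w -> `|z| = `|w| ].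

Definition trR A : 'M[R]_d := (map_mx intr A)^T.

Definition invtrR A : 'M[R]_d := invmx (trR A).

Definition absdet A : R := `|\det A|%:~R.

Definition sym_posdef Q : Prop :=
  Q^T = Q /\ forall x : 'cV[R]_d, x != 0 -> 0 < (x^T *m Q *m x) 0 0.

Definition isotropic_factor A Q : Prop :=
  sym_posdef Q /\
  exists2 U, U^T *m U = 1%:M &
    invtrR A = absdet A `^ (- d%:R^-1) *: (invmx Q *m U *m Q).

Definition G Q xi : R :=
  let q := Q *m Q in
  4 * (\sum_(i < d) q i i * sin (xi i 0 / 2) ^+ 2) +
  2 * (\sum_(i < d) \sum_(j < d | (i < j)%N)
         q i j * sin (xi i 0) * sin (xi j 0)).

Definition SAT A : set 'cV[R]_d :=
  [set s : 'cV[R]_d | (forall i, 0 <= s i 0 < 1) /\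
           (forall i, (trR A *m s) i 0 \is a Num.int)].

(* The index set is finite when A is invertible, so that this is the actual
   finite product. *)
Definition m0 A Q xi : R :=
  \big[*%R/1]_(s \in SAT A `\ 0) (G Q (xi + (2 * pi) *: s) / G Q ((2 * pi) *: s)).

(* Fourier transform of the scaling function; a tempered distribution is
   determined by its Fourier transform, and this is how the scaling function
   is defined. When A is an isotropic dilation and Q an associated factor, the
   product converges at every xi, since m0 is smooth with m0(0) = 1 and the
   powers of A^{-T} decay geometrically. *)
Definition phihat A Q xi : R :=
  limn (fun n => \prod_(1 <= j < n.+1) m0 A Q (invtrR A ^+ j *m xi)).

(* Convolution of the scaling functions is multiplication on the Fourier
   side: phi^1 = phi and phi^m = phi * phi^(m-1). *)
Definition phihat_order A Q (m : nat) xi : R := phihat A Q xi ^+ m.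

End Elliptic.

(* Main.v *)
Require Import Defs.
From mathcomp Require Import all_boot all_order all_algebra.
From mathcomp Require Import all_classical all_reals all_analysis.
From mathcomp Require Import zify ring lra.
Import Order.TTheory GRing.Theory Num.Theory.
Local Open Scope ring_scope.

(** Everything reduces to the pointwise positivity of the trigonometric symbol
    [G] ([G_ge0]): the mask is a product of quotients of values of [G], and
    [phihat] is a limit of products of values of the mask.

    To see that [G] is nonnegative, write q = Q^2 and compare [G] with the
    quadratic form of q at the vector x with x_i = sin xi_i.  The two
    expressions have the same off-diagonal terms, and their difference is
      sum_i q_ii (4 sin^2 (xi_i / 2) - sin^2 xi_i),
    which is nonnegative because q_ii >= 0 and
    sin^2 t = 4 sin^2 (t/2) cos^2 (t/2) <= 4 sin^2 (t/2) ([sqr_sin_le]).  The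
    quadratic form itself is nonnegative, since for symmetric Q it is the
    squared length of Q x ([sqr_mx_quad_ge0]). *)

(** In the divergent case [limn] takes its default value, which is 0. *)
Lemma limn_ge0 (R : realType) (u : nat -> R^o) :
  (forall n, 0 <= u n) -> 0 <= limn u.
Proof.
move=> u0; have [cu|ncu] := pselect (cvgn u).
  by apply: limr_ge => //; apply: nearW.
by rewrite (dvgP ncu).
Qed.

Lemma sqr_sin_le (R : realType) (x : R) : sin x ^+ 2 <= 4 * sin (x / 2) ^+ 2.
Proof.
have {1}-> : x = (x / 2) *+ 2 by rewrite -mulr_natr divfK.
rewrite sin_mulr2n -mulr_natl 2!exprMn cos2sin2.
by have := sqr_ge0 (sin (x / 2)); nra.
Qed.

Lemma sum_sym_split (R : pzSemiRingType) (d : nat) (a : 'I_d -> 'I_d -> R) :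
  (forall i j, a i j = a j i) ->
  \sum_i \sum_j a i j =
  \sum_i a i i + 2 * \sum_(i < d) \sum_(j < d | (i < j)%N) a i j.
Proof.
move=> asym.
have -> : \sum_i \sum_j a i j = \sum_i (a i i +
    (\sum_(j < d | (i < j)%N) a i j + \sum_(j < d | (j < i)%N) a i j)).
  apply: eq_bigr => i _; rewrite (bigD1 i) //=; congr (_ + _).
  rewrite (bigID (fun j : 'I_d => (i < j)%N)) /=; congr (_ + _);
    apply: eq_bigl => j; rewrite -val_eqE /=; lia.
rewrite !big_split /= mulr2n mulrDl mul1r; congr (_ + (_ + _)).
rewrite (exchange_big_dep xpredT) //=.
by apply: eq_bigr => i _; apply: eq_bigr => j _.
Qed.

(** For symmetric Q the form x^T Q^2 x equals (Q x)^T (Q x), a sum of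
    squares. *)
Lemma sqr_mx_quad_ge0 (R : realDomainType) (d : nat) (Q : 'M[R]_d)
    (x : 'I_d -> R) :
  Q^T = Q -> 0 <= \sum_i \sum_j (Q *m Q) i j * x i * x j.
Proof.
move=> Qsym.
suff -> : \sum_i \sum_j (Q *m Q) i j * x i * x j =
          \sum_k (\sum_i Q k i * x i) ^+ 2.
  by apply: sumr_ge0 => k _; exact: sqr_ge0.
under [RHS]eq_bigr => k _.
  rewrite expr2 big_distrlr /=; over.
rewrite [RHS]exchange_big /=; apply: eq_bigr => i _.
rewrite [RHS]exchange_big /=; apply: eq_bigr => j _.
rewrite mxE !mulr_suml; apply: eq_bigr => k _.
by rewrite -{1}Qsym mxE; ring.
Qed.

(** [G] dominates the quadratic form of Q^2 at the vector of sines: after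
    cancelling the common off-diagonal terms, the comparison is
    [sqr_sin_le] weighted by the diagonal of Q^2. *)
Lemma G_ge0 (R : realType) (d : nat) (Q : 'M[R]_d) (xi : 'cV[R]_d) :
  Q^T = Q -> 0 <= G Q xi.
Proof.
move=> Qsym; rewrite /G; set q := Q *m Q; pose x (i : 'I_d) := sin (xi i 0).
have qsym i j : q i j = q j i.
  by rewrite -{1}[q]trmxK mxE /q trmx_mul Qsym.
have := sqr_mx_quad_ge0 _ _ _ x Qsym; rewrite sum_sym_split; last first.
  by move=> i j; rewrite -/q qsym; ring.
move=> /le_trans; apply; rewrite lerD2r mulr_sumr.
apply: ler_sum => i _; rewrite -mulrA -expr2 [leRHS]mulrCA.
apply: ler_wpM2l; last exact: sqr_sin_le.
(* A diagonal entry of Q^2 is the squared length of a row of Q. *)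
rewrite mxE; apply: sumr_ge0 => k _.
by rewrite -{1}Qsym mxE -expr2 sqr_ge0.
Qed.

Lemma m0_ge0 (R : realType) (d : nat) (A : 'M[int]_d) (Q : 'M[R]_d) xi :
  Q^T = Q -> 0 <= m0 A Q xi.
Proof.
move=> Qsym; rewrite /m0.
apply: (big_ind (fun y => 0 <= y)) => [//|y z|s _]; first exact: mulr_ge0.
by rewrite divr_ge0 // G_ge0.
Qed.

Lemma phihat_ge0 (R : realType) (d : nat) (A : 'M[int]_d) (Q : 'M[R]_d) xi :
  Q^T = Q -> 0 <= phihat A Q xi.
Proof.
move=> Qsym; apply: limn_ge0 => n.
by apply: prodr_ge0 => j _; exact: m0_ge0.
Qed.

Theorem mainTheorem7 (R : realType) (d : nat) (hd : (0 < d)%N)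
    (A : 'M[int]_d) (hA : isotropic_dilation R A)
    (Q : 'M[R]_d) (hQ : isotropic_factor A Q)
    (m : nat) (hm : (1 <= m)%N) :
  forall xi : 'cV[R]_d, 0 <= phihat_order A Q m xi.
Proof.
move=> xi; have [[Qsym _] _] := hQ.
by rewrite exprn_ge0 // phihat_ge0.
Qed.
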